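(* Let $\Lambda^*\subset\mathbb{R}$ be a Cantor set. Then there exists a continuous function $F^*:\mathbb{R}\to\mathbb{R}$ such that both of the following hold: (i) if $x\in\Lambda^*$, then $(F^* )^n(x)\in\Lambda^*$ for all $n\ge 1$; (ii) if $x\in\mathbb{R}\setminus\Lambda^*$, then $(F^* )^n(x)$ diverges to infinity.
   Context: For $F:\mathbb{R}\to\mathbb{R}$, $F^n$ denotes the $n$-fold iterate: $F^1=F$, $F^{n+1}=F\circ F^n$. ''$F^n(x)$ diverges to infinity'' means $|F^n(x)|\to\infty$ as $n\to\infty$. A Cantor set is a nonempty topological space that is totally disconnected (its connected components are exactly its one-point subsets), perfect (closed, and every point is a limit point) and compact; a Cantor set in $\mathbb{R}$ is a subset of $\mathbb{R}$ that is a Cantor set in the subspace topology. *)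

(* Defs.v *)
From mathcomp Require Import all_boot all_order all_algebra.
From mathcomp Require Import all_classical all_reals all_analysis.

Set Implicit Arguments.
Unset Strict Implicit.
Unset Printing Implicit Defensive.

Import Order.TTheory GRing.Theory Num.Theory.
Import numFieldNormedType.Exports.

Local Open Scope classical_set_scope.
Local Open Scope ring_scope.

Definition cantor_set (T : topologicalType) : Prop :=
  [/\ [set: T] !=set0,
      totally_disconnected [set: T],
      perfect_set [set: T] &
      compact [set: T]].

(* [set_type L] carries the initial topology of the inclusion, i.e., the
   subspace topology; [subspace L] would instead keep the points outside [L]
   as isolated points. *)
Definition cantor_subset (X : topologicalType) (L : set X) : Prop :=
  cantor_set (set_type L).

(* Main.v *)
(* Send every point of the Cantor set L to its minimum m, and every other point
   strictly to the left of m, by F x = m - 2 d(x, L). Left of m one has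
   d(x, L) = m - x, so F is there the expansion x |-> m - 2 (m - x) and orbits
   go to -oo. Only nonemptiness and compactness of L matter, since F is not
   required to map L onto itself. *)
Require Import Defs.
From mathcomp Require Import all_boot all_order all_algebra.
From mathcomp Require Import all_classical all_reals all_analysis.
From mathcomp Require Import lra.

Set Implicit Arguments.
Unset Strict Implicit.
Unset Printing Implicit Defensive.

Import Order.TTheory GRing.Theory Num.Theory.
Import numFieldNormedType.Exports.

Local Open Scope classical_set_scope.
Local Open Scope ring_scope.

(** The inclusion [set_val] is continuous for the initial topology and its image is [A]. *)
Lemma compact_set_type (X : topologicalType) (A : set X) :
  compact [set: set_type A] -> compact A.
Proof.
move=> cA; suff -> : A = set_val @` [set: set_type A].
  apply: continuous_compact => //; apply: continuous_subspaceT.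
  exact: (@initial_continuous (set_type A) X set_val).
apply/seteqP; split => [x Ax|_ [[x xA] _ <-]]; last exact: set_mem xA.
by exists (exist _ x (mem_set Ax)).
Qed.

(** For each [x], the continuous map [y |-> |x - y|] attains its minimum on [A]; choice collects the
    minimizers. Thus [|x - p x|] is d(x, A). *)
Lemma compact_nearest_point (R : realType) (A : set R) :
  A !=set0 -> compact A ->
  exists p : R -> R, (forall x, A (p x)) /\
    forall x y, A y -> `|x - p x| <= `|x - y|.
Proof.
move=> A0 cA.
have near_ex x : exists p, A p /\ forall y, A y -> `|x - p| <= `|x - y|.
  have /(compact_EVT_min A0 cA)[p /set_mem Ap pmin] :
      {within A, continuous (fun y => `|x - y|)}.
    apply: continuous_subspaceT => y.
    by apply: cvg_norm; apply: cvgB; [exact: cvg_cst|exact: cvg_id].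
  by exists p; split=> // y Ay; apply: pmin; rewrite inE.
have [p pP] := choice near_ex.
by exists p; split=> [x|x y Ay]; [case: (pP x)|case: (pP x) => _; exact].
Qed.

(** The distance is 1-Lipschitz by the triangle inequality, even where [p] itself jumps between
    equally near points. *)
Lemma nearest_point_dist_continuous (R : realType) (A : set R) (p : R -> R) :
  (forall x, A (p x)) -> (forall x y, A y -> `|x - p x| <= `|x - y|) ->
  continuous (fun x => `|x - p x|).
Proof.
move=> Ap pmin x; apply/cvgrPdist_le => e e0.
have lip u v : `|u - p u| <= `|u - v| + `|v - p v|.
  by rewrite (le_trans (pmin _ _ (Ap v)))// ler_distD.
near=> y; apply: (@le_trans _ _ `|x - y|).
  by rewrite ler_distl; have := lip x y; have := lip y x; rewrite (distrC y x); lra.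
near: y; exact: cvgr_dist_le.
Unshelve. all: by end_near. Qed.

Theorem theorem1 (R : realType) (L : set R) (hL : cantor_subset L) :
  exists F : R -> R,
    [/\ continuous F,
        forall x, L x -> forall n, (1 <= n)%N -> L (iter n F x) &
        forall x, ~ L x -> `|iter n F x| @[n --> \oo] --> +oo].
Proof.
case: hL => [[[a /set_mem La] _] _ _ /compact_set_type cL].
have L0 : L !=set0 by exists a.
have [m /set_mem Lm minm] : exists2 m, m \in L & forall t, t \in L -> m <= t.
  by apply: (@compact_EVT_min _ _ id) => //; apply: continuous_subspaceT => x.
have mL y : L y -> m <= y by move=> Ly; apply: minm; rewrite inE.
have [p [Lp pmin]] := compact_nearest_point L0 cL.
pose F x := m - 2 * `|x - p x|.
have FL x : L x -> F x = m.
  move=> Lx; suff : `|x - p x| = 0 by rewrite /F => ->; rewrite mulr0 subr0.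
  by apply/eqP; rewrite eq_le normr_ge0 (le_trans (pmin x x Lx))// subrr normr0.
exists F; split.
- move=> x; apply: cvgB; first exact: cvg_cst.
  apply: cvgM; first exact: cvg_cst.
  exact: (nearest_point_dist_continuous Lp pmin).
- move=> x Lx [//|n] _; elim: n => [|n IH]; first by rewrite /= FL.
  by rewrite iterS FL.
- move=> x nLx.
  (* The distance is at most [t] because [m] is in [L], and at least [t] because [p (m - t)] lies in
     [L], hence right of [m]. *)
  have Fleft t : 0 <= t -> F (m - t) = m - 2 * t.
    move=> t0; suff dt : `|m - t - p (m - t)| = t by rewrite /F dt.
    apply/eqP; rewrite eq_le; apply/andP; split.
      by rewrite (le_trans (pmin _ m Lm))// addrAC subrr add0r normrN ger0_norm.
    rewrite distrC (le_trans _ (ler_norm _))//; have := mL _ (Lp (m - t)); lra.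
  pose t := 2 * `|x - p x|.
  have t0 : 0 < t.
    rewrite mulr_gt0// normr_gt0 subr_eq0; apply: contra_notN nLx => /eqP ->.
    exact: Lp.
  (* The formula starts at the first iterate: [x] may lie anywhere off [L], but [F x = m - t] is
     left of [m], where [Fleft] applies. *)
  have iterF n : iter n.+1 F x = m - 2 ^+ n * t.
    elim: n => [|n IH]; first by rewrite expr0 mul1r.
    by rewrite iterS IH Fleft ?exprS ?mulrA// mulr_ge0 ?exprn_ge0// ltW.
  rewrite -cvg_shiftS.
  (* Since n <= 2^n, the absolute values dominate the arithmetic sequence n t - m, which tends to
     infinity as [t] is positive. *)
  apply: (@ger_cvgy _ _ _ _ (arithmetic (- m) t)); last exact: cvg_arithmetic.
  apply: nearW => n /=; rewrite -iterS iterF.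
  have : t *+ n <= 2 ^+ n * t.
    by rewrite -mulr_natl ler_wpM2r ?(ltW t0)// -natrX ler_nat ltnW// ltn_expl.
  by rewrite distrC => ?; rewrite (le_trans _ (ler_norm _))// addrC; lra.
Qed.
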